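(* Let $P:\{0,1\}^3\to\{0,1\}$ be a predicate. (a) If $P$ has no affine projection to AND, then there are absolute constants $C,c$ such that for every $0<\varepsilon<1$ and every instance of CSP$(P)$ on $k$ Boolean variables, the instance has a $(1\pm\varepsilon)$-sparsifier using at most $C\frac{k}{\varepsilon^2}(\log_2(4k/\varepsilon))^{c}$ constraints. (b) If $P$ has an affine projection to AND, then there is a constant $c_0>0$ such that for every $\varepsilon\in[0,1)$ and every sufficiently large $k$ there is an instance of CSP$(P)$ on $k$ Boolean variables for which every $(1\pm\varepsilon)$-sparsifier uses at least $c_0k^2$ constraints.
   Context: A predicate $P:\{0,1\}^r\to\{0,1\}$ has an affine projection to AND if there exists $\pi:[r]\to\{0,1,x,\neg x,y,\neg y\}$ such that $\mathrm{AND}(x,y)=P(\pi(1),\dots,\pi(r))$ for all $x,y\in\{0,1\}$. An instance of CSP$(P)$ on Boolean variables $x_1,\dots,x_k$ is a list of constraints $C_j = P(x_{j,1},\dots,x_{j,r})$, $j\in[m]$, each applying $P$ to an $r$-tuple of the variables; its value on an assignment $x\in\{0,1\}^k$ is $\sum_j C_j(x)$. A $(1\pm\varepsilon)$-sparsifier is a subset $T\subseteq[m]$ with nonnegative weights $(w_j)_{j\in T}$ such that for every $x\in\{0,1\}^k$, $(1-\varepsilon)\sum_{j=1}^mC_j(x)\le\sum_{j\in T}w_jC_j(x)\le(1+\varepsilon)\sum_{j=1}^mC_j(x)$. *)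

(* Defs.v *)
From Stdlib Require Import Reals.
From mathcomp Require Import all_boot all_order all_algebra.
From mathcomp Require Import Rstruct.
Set Implicit Arguments. Unset Strict Implicit. Unset Printing Implicit Defensive.
Import Order.TTheory GRing.Theory Num.Theory.
Local Open Scope ring_scope.

Definition pred_r (r : nat) := {ffun 'I_r -> bool} -> bool.

Inductive lit := L0 | L1 | LX | LNX | LY | LNY.

Definition eval_lit (l : lit) (x y : bool) : bool :=
  match l with
  | L0 => false | L1 => true | LX => x | LNX => ~~ x | LY => y | LNY => ~~ y
  end.

Definition affine_proj_AND (r : nat) (P : pred_r r) : Prop :=
  exists pi : 'I_r -> lit,
    forall x y : bool, P [ffun i => eval_lit (pi i) x y] = x && y.

(* An instance of CSP(P) on variables x_1..x_k with m constraints is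
   cs : 'I_m -> 'I_r -> 'I_k, constraint j being P(x_{cs j 0},...,x_{cs j (r-1)}). *)
Definition constr_val (r k m : nat) (P : pred_r r) (cs : 'I_m -> 'I_r -> 'I_k)
  (j : 'I_m) (x : {ffun 'I_k -> bool}) : R :=
  (P [ffun i => x (cs j i)] : nat)%:R.

Definition csp_value (r k m : nat) (P : pred_r r) (cs : 'I_m -> 'I_r -> 'I_k)
  (x : {ffun 'I_k -> bool}) : R :=
  \sum_(j < m) constr_val P cs j x.

Definition is_sparsifier (r k m : nat) (P : pred_r r) (cs : 'I_m -> 'I_r -> 'I_k)
  (eps : R) (T : {set 'I_m}) (w : 'I_m -> R) : Prop :=
  (forall j, j \in T -> 0 <= w j) /\
  (forall x : {ffun 'I_k -> bool},
     (1 - eps) * csp_value P cs x <= \sum_(j in T) w j * constr_val P cs j x /\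
     \sum_(j in T) w j * constr_val P cs j x <= (1 + eps) * csp_value P cs x).

Definition log2 (x : R) : R := ln x / ln 2.

(* Main.v *)
(* If P has no affine projection to AND, then P^-1(1) is the complement in {0,1}^3 of an
   affine hyperplane over F_2 or F_5 (a finite check), so constraint j is satisfied by x
   exactly when a vector built from x lies outside a subgroup H_j of V = F_p^(k+1).
   Sparsification then follows Benczur and Karger's cut sparsification.  Write K(B) for
   the intersection of the H_j, j in B, and r(B) for the logarithm of its index, which is
   submodular.  Peeling off parts of least strength yields sampling rates u_j of total at
   most r and nested layers E, a nonnegative combination of which recovers the constraints,
   such that u(E \ B) >= r(E) - r(B) for B in E.  By Karger's contraction argument a layer
   has at most (p (n+1))^a traces x |-> {j in E : x notin H_j} of u-weight at most a, where
   n = dim V, so a union bound over layers and traces shows that keeping j with probability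
   min(1, rho u_j), rho ~ log(n) / eps^2, preserves every layer up to eps.

   Conversely an affine projection to AND embeds the n^2 constraints AND(x_i, y_j), each of
   which is the only one satisfied by some assignment. *)
Require Import Defs.
From Stdlib Require Import Reals.
From mathcomp Require Import all_boot all_order all_algebra all_fingroup all_solvable.
From mathcomp Require Import Rstruct.
From mathcomp Require Import ring lra zify.
Import Order.TTheory GRing.Theory Num.Theory.
Local Open Scope group_scope.
Local Open Scope ring_scope.
Set Implicit Arguments.
Unset Strict Implicit.
#[local] Arguments exp _%_ring_scope.
#[local] Arguments ln _%_ring_scope.

(** * Strength decomposition of a submodular rank *)

(** When [r] is the rank of a connected graph, this says that the edges between the classes of any
    partition weigh at least the number of classes minus one. *)
Definition rank_dense (K : numDomainType) (I : finType) (r : {set I} -> nat) (u : I -> K)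
    (E : {set I}) : Prop :=
  forall B : {set I}, B \subset E -> (r E)%:R - (r B)%:R <= \sum_(j in E :\: B) u j.

(* The set [B1] minimizing [#|E \ B| / (r E - r B)] leaves on [E \ B1] the part of least
   strength [d1]; it gets weights [1 / d1], and the rest is treated by induction inside
   [B1], whose strength is at least [d1]. *)
Lemma strength_layers (K : realFieldType) (I : finType) (r : {set I} -> nat) :
    r set0 = 0%N ->
    (forall A B : {set I}, A \subset B -> (r A <= r B)%N) ->
    (forall A B : {set I}, (r (A :|: B) + r (A :&: B) <= r A + r B)%N) ->
  forall (E : {set I}) (d0 : K), 0 <= d0 ->
    (forall B : {set I}, B \subset E -> d0 * ((r E)%:R - (r B)%:R) <= #|E :\: B|%:R) ->
  exists (u : I -> K) (L : seq (K * {set I})),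
    [/\ (forall j, 0 <= u j) /\ rank_dense r u E,
        \sum_(j in E) u j <= (r E)%:R,
        (size L <= r E)%N,
        forall l, l \in L -> [/\ 0 <= l.1, l.2 \subset E & rank_dense r u l.2] &
        forall j, j \in E -> (0 < r [set j])%N ->
          \sum_(l <- L) l.1 * (j \in l.2)%:R * u j = 1 - d0 * u j].
Proof.
move=> r0 rmono rsub E; elim: {E}#|E| {-2}E (leqnn #|E|) => [|n IHn] E.
  rewrite leqn0 cards_eq0 => /eqP -> d0 _ _.
  exists (fun=> 0), [::]; split => //=; last by move=> j; rewrite inE.
    by split=> // B _; rewrite r0 big1 // sub0r oppr_le0.
  by rewrite big_set0.
move=> En d0 d0_ge0 dE.
have [rE0|rE_gt0] := posnP (r E).
  exists (fun=> 0), [::]; split => //=; [|by rewrite big1|].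
    by split=> // B _; rewrite rE0 big1 // sub0r oppr_le0.
  move=> j jE; rewrite ltnNge (leq_trans (rmono _ E _)) ?rE0 //.
  by rewrite sub1set.
pose den (B : {set I}) : K := #|E :\: B|%:R / ((r E)%:R - (r B)%:R).
pose Q := [pred B : {set I} | (B \subset E) && (r B < r E)%N].
have Q0 : Q set0 by rewrite /= sub0set r0.
case: (arg_minP den Q0) => B1 /andP[B1E rB1] B1min.
set d1 := den B1.
have gap_gt0 (B : {set I}) : (r B < r E)%N -> 0 < (r E)%:R - (r B)%:R :> K.
  by move=> h; rewrite subr_gt0 ltr_nat.
have E1dE : #|E :\: B1|%:R = d1 * ((r E)%:R - (r B1)%:R).
  by rewrite /d1 /den divfK // gt_eqF // gap_gt0.
have EB1_gt0 : (0 < #|E :\: B1|)%N.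
  rewrite card_gt0; apply: contraTneq rB1 => /eqP; rewrite setD_eq0 => EB1.
  by rewrite -leqNgt rmono.
have d1_gt0 : 0 < d1 by rewrite divr_gt0 ?ltr0n // gap_gt0.
have d01 : d0 <= d1 by rewrite ler_pdivlMr ?gap_gt0 // dE.
have d1E (B : {set I}) : B \subset E -> d1 * ((r E)%:R - (r B)%:R) <= #|E :\: B|%:R.
  move=> BE; have [h|h] := ltnP (r B) (r E).
    by rewrite -ler_pdivlMr ?gap_gt0 //; apply: B1min; rewrite /= BE.
  apply: le_trans (ler0n _ _); rewrite mulr_ge0_le0 ?(ltW d1_gt0) //.
  by rewrite subr_le0 ler_nat.
have cardD (B : {set I}) : B \subset B1 ->
    (#|E :\: B| = #|E :\: B1| + #|B1 :\: B|)%N.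
  move=> BB1; have h1 := cardsDS B1E; have h2 := cardsDS BB1.
  have h3 := cardsDS (subset_trans BB1 B1E).
  by have := subset_leq_card B1E; have := subset_leq_card BB1; lia.
have B1n : (#|B1| <= n)%N.
  by have := cardsDS B1E; have := subset_leq_card B1E; lia.
have dB1 (B : {set I}) : B \subset B1 ->
    d1 * ((r B1)%:R - (r B)%:R) <= #|B1 :\: B|%:R.
  move=> BB1; have := d1E B (subset_trans BB1 B1E).
  by rewrite cardD // natrD E1dE; lra.
have [u [L [[u_ge0 uB1] su sL hL cov]]] := IHn B1 B1n d1 (ltW d1_gt0) dB1.
pose u' j := if j \in B1 then u j else d1^-1.
have u'B1 (A : {set I}) : A \subset B1 -> \sum_(j in A) u' j = \sum_(j in A) u j.
  by move=> AB; apply: eq_bigr => j jA; rewrite /u' (subsetP AB).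
have u'D (A : {set I}) : [disjoint A & B1] -> \sum_(j in A) u' j = #|A|%:R / d1.
  move=> AB; rewrite (eq_bigr (fun=> d1^-1)).
    by rewrite sumr_const [RHS]mulr_natl.
  by move=> j jA; rewrite /u' (disjointFr AB).
have dis (A : {set I}) : [disjoint A :\: B1 & B1].
  by rewrite disjoints_subset; apply/subsetP => j; rewrite !inE => /andP[].
(* Inside [B1] the inductive density applies to [B :&: B1], outside it the minimality of [d1]
   applies to [B :|: B1]; submodularity bounds the sum of the two gaps below by the gap of [B]. *)
have dEu : rank_dense r u' E.
  move=> B BE /=.
  rewrite (big_setID B1) /=.
  have -> : (E :\: B) :&: B1 = B1 :\: (B :&: B1).
    apply/setP => j; rewrite !inE.
    case: (boolP (j \in B1)) => [/(subsetP B1E) ->|]; last by rewrite !andbF.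
    by rewrite !andbT.
  have -> : (E :\: B) :\: B1 = E :\: (B :|: B1) by rewrite setDDl.
  rewrite u'B1 ?subsetDl // u'D; last by rewrite -setDDl dis.
  have hB1 : (r B1)%:R - (r (B :&: B1))%:R <= \sum_(j in B1 :\: B :&: B1) u j.
    by apply: uB1; rewrite subsetIr.
  have := d1E (B :|: B1); rewrite subUset BE B1E => /(_ isT).
  rewrite mulrC -ler_pdivlMr // => h.
  have := rsub B B1; rewrite -(ler_nat K) !natrD; lra.
(* On [B1] the inner layers reach only [1 - d1 * u j], and the new layer adds the missing
   [(d1 - d0) * u j]. Off [B1] the new layer alone gives [(d1 - d0) / d1 = 1 - d0 / d1]. *)
exists u', ((d1 - d0, E) :: L); split.
- split=> // j; rewrite /u'; case: ifP => _ //; rewrite invr_ge0; exact: ltW.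
- rewrite (big_setID B1) /= (setIidPr B1E) u'B1 // u'D // E1dE mulrC mulKf ?gt_eqF //.
  lra.
- by rewrite /=; lia.
- move=> l; rewrite inE => /orP[/eqP ->|/hL[h1 h2 h3]] /=.
    by split; [rewrite /= subr_ge0| |].
  split => //; first exact: subset_trans h2 B1E.
  move=> B Bl; rewrite u'B1 ?h3 //.
  exact: subset_trans (subsetDl _ _) h2.
- move=> j jE rj; rewrite big_cons /= jE mulr1 /u'.
  case: (boolP (j \in B1)) => jB1; first by rewrite (cov j) //; lra.
  rewrite big_seq big1.
    by rewrite addr0 mulrBl mulfV // gt_eqF.
  move=> l /hL[_ /subsetP lB1 _]; rewrite (negbTE (contra (lB1 j) jB1)).
  by rewrite mulr0 mul0r.
Qed.

(** * Counting light traces *)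

Definition common (gT : finGroupType) (I : finType) (H : I -> {group gT}) (B : {set I}) :
  {group gT} := [group of \bigcap_(j in B) H j].

Definition corank (gT : finGroupType) (p : nat) (I : finType) (H : I -> {group gT})
  (B : {set I}) : nat := (logn p #|gT| - logn p #|common H B|)%N.

Lemma commonP (gT : finGroupType) (I : finType) (H : I -> {group gT}) (B : {set I}) x :
  reflect (forall j, j \in B -> x \in H j) (x \in common H B).
Proof. exact: bigcapP. Qed.

Lemma common_anti (gT : finGroupType) (I : finType) (H : I -> {group gT})
  (A B : {set I}) : A \subset B -> common H B \subset common H A.
Proof.
move=> /subsetP AB; apply/subsetP => x /commonP xB.
by apply/commonP => j /AB; apply: xB.
Qed.

Lemma card_common (gT : finGroupType) (p : nat) (I : finType) (H : I -> {group gT})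
    (B : {set I}) :
  p.-group [set: gT] -> #|common H B| = (p ^ logn p #|common H B|)%N.
Proof. by move=> pG; apply/card_pgroup/(pgroupS (subsetT _) pG). Qed.

Lemma corankE (gT : finGroupType) (p : nat) (I : finType) (H : I -> {group gT})
  (B : {set I}) : (corank p H B + logn p #|common H B|)%N = logn p #|gT|.
Proof.
rewrite /corank subnK // -cardsT.
by apply: dvdn_leq_log; [exact: cardG_gt0 | exact: (cardSg (subsetT _))].
Qed.

Lemma corank0 (gT : finGroupType) (p : nat) (I : finType) (H : I -> {group gT}) :
  corank p H set0 = 0%N.
Proof. by rewrite /corank /common /= big_set0 cardsT subnn. Qed.

Lemma corank_mono (gT : finGroupType) (p : nat) (I : finType) (H : I -> {group gT})
  (A B : {set I}) : A \subset B -> (corank p H A <= corank p H B)%N.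
Proof.
move=> AB; rewrite /corank leq_sub2l // dvdn_leq_log //.
exact/cardSg/common_anti.
Qed.

(** The product of [common H A] and [common H B] lies in [common H (A :&: B)], and their
    intersection is [common H (A :|: B)]; the product formula for orders does the rest. *)
Lemma corank_submod (gT : finGroupType) (p : nat) (I : finType) (H : I -> {group gT})
    (A B : {set I}) :
  prime p -> p.-group [set: gT] ->
  (corank p H (A :|: B) + corank p H (A :&: B) <= corank p H A + corank p H B)%N.
Proof.
move=> p_pr pG.
have KU : common H (A :|: B) :=: common H A :&: common H B.
  apply/setP => x; rewrite inE; apply/commonP/andP => [h|[/commonP hA /commonP hB] j].
    by split; apply/commonP => j jX; apply: h; rewrite inE jX ?orbT.
  by rewrite inE => /orP[/hA|/hB].
have KM : (common H A * common H B)%g \subset common H (A :&: B).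
  by rewrite mul_subG ?common_anti ?subsetIl ?subsetIr.
have := subset_leq_card KM; have := mul_cardG (common H A) (common H B).
rewrite -KU => h1 h2.
have {h1 h2} : (#|common H A| * #|common H B| <=
    #|common H (A :&: B)| * #|common H (A :|: B)|)%N by rewrite h1 leq_mul2r h2 orbT.
rewrite (card_common H A pG) (card_common H B pG) (card_common H (A :&: B) pG).
rewrite (card_common H (A :|: B) pG) -!expnD leq_exp2l ?prime_gt1 //.
have := corankE p H A; have := corankE p H B.
by have := corankE p H (A :|: B); have := corankE p H (A :&: B); lia.
Qed.

Lemma corank_lt (gT : finGroupType) (p : nat) (I : finType) (H : I -> {group gT})
    (A B : {set I}) : prime p -> p.-group [set: gT] ->
  common H B \proper common H A -> (corank p H A < corank p H B)%N.
Proof.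
move=> p_pr pG /proper_card.
rewrite (card_common H A pG) (card_common H B pG) ltn_exp2l ?prime_gt1 //.
by have := corankE p H A; have := corankE p H B; lia.
Qed.

(** The factor [n / (n - a)] gained by the binomial in [card_light] is the inverse of the survival
    probability of one contraction. *)
Lemma bin_maxn_step n a : (a < n)%N -> (n * 'C(maxn n.-1 a, a) = (n - a) * 'C(maxn n a, a))%N.
Proof.
move=> an; have -> : maxn n.-1 a = n.-1 by lia.
have -> : maxn n a = n by lia.
exact: mul_bin_down.
Qed.

(* Karger's contraction argument: a random element [j] of [E], drawn with
   probability proportional to [u j] among those for which [H j] does not contain
   [common H B], keeps a light [x] in [H j] with probability at least [1 - a / s]. *)
Lemma card_light (K : realFieldType) (gT : finGroupType) (p : nat) (I : finType)
    (H : I -> {group gT}) (u : I -> K) (E : {set I}) (a : nat) :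
    prime p -> p.-group [set: gT] -> (forall j, 0 <= u j) ->
    rank_dense (corank p H) u E ->
  forall (s : nat) (B : {set I}), B \subset E -> (corank p H E - corank p H B <= s)%N ->
  (#|[set x in common H B | (\sum_(j in E | x \notin H j) u j <= a%:R)%R]|
     <= #|common H E| * ('C(maxn s a, a) * p ^ a))%N.
Proof.
move=> p_pr pG u_ge0 dE.
(* For [s <= a] even the trivial bound by the order of [common H B] suffices. *)
have base s (B : {set I}) : B \subset E -> (s <= a)%N ->
    (corank p H E - corank p H B <= s)%N ->
    (#|[set x in common H B | (\sum_(j in E | x \notin H j) u j <= a%:R)%R]|
      <= #|common H E| * ('C(maxn s a, a) * p ^ a))%N.
  move=> BE sa hs; have -> : maxn s a = a by lia.
  rewrite binn mul1n.
  apply: (@leq_trans #|common H B|).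
    by apply/subset_leq_card/subsetP => x; rewrite inE => /andP[].
  rewrite (card_common H B pG) (card_common H E pG) -expnD leq_exp2l ?prime_gt1 //.
  by have := corankE p H B; have := corankE p H E; lia.
elim=> [|s IHs] B BE hs; first by apply: (base _ B BE _ hs).
have [sa|sa] := boolP (a < s.+1)%N; last by apply: (base _ B BE _ hs); rewrite leqNgt.
(* The closure of [B] in [E]: contracting an element outside it strictly shrinks [common H B]. *)
pose B' := [set j in E | common H B \subset H j].
have BB' : B \subset B'.
  apply/subsetP => j jB; rewrite inE (subsetP BE) //=.
  by apply/subsetP => x /commonP; apply.
have KB' : common H B' = common H B.
  apply/val_inj/eqP; rewrite /= eqEsubset (common_anti H BB') /=.
  apply/subsetP => x xB; apply/commonP => j; rewrite inE => /andP[_ /subsetP].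
  exact.
set W := finset _; set g := (_ * (_ * _))%N.
pose sg : K := \sum_(j in E :\: B') u j.
have [hlt|hge] := leqP (corank p H E - corank p H B) s.
  apply: leq_trans (IHs B BE hlt) _.
  rewrite leq_mul2l leq_mul2r; apply/orP; right; apply/orP; right.
  by apply: leq_bin2l; lia.
have sg_ge : s.+1%:R <= sg.
  apply: le_trans (dE B' _); last by apply/subsetP => j; rewrite inE => /andP[].
  have := corank_mono p H BE; rewrite /corank KB' -/(corank p H B) -/(corank p H E).
  by move=> h; rewrite -natrB // ler_nat; lia.
pose g' := (#|common H E| * ('C(maxn s a, a) * p ^ a))%N.
have cnt j : j \in E :\: B' -> (#|W :&: H j| <= g')%N.
  rewrite !inE => /andP[]; case jE: (j \in E) => //= jB _.
  have jBE : j |: B \subset E by rewrite subUset sub1set jE.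
  apply: leq_trans (IHs _ jBE _).
    apply/subset_leq_card/subsetP => x; rewrite !inE => /andP[/andP[/commonP xB ->] xj].
    rewrite andbT; apply/commonP => i; rewrite !inE => /orP[/eqP -> //|]; exact: xB.
  suff : (corank p H B < corank p H (j |: B))%N by lia.
  apply: corank_lt => //; rewrite properE common_anti ?subsetUr //=.
  apply: contra jB => /subset_trans; apply; apply/subsetP => x /commonP; apply.
  by rewrite !inE eqxx.
have split_sg x : x \in W ->
    sg = \sum_(j in E | x \notin H j) u j + \sum_(j in E :\: B' | x \in H j) u j.
  rewrite inE => /andP[xB _].
  rewrite /sg (bigID (fun j => x \in H j)) /= addrC; congr (_ + _).
  apply: eq_bigl => j; rewrite !inE; case: (j \in E) => //=; rewrite ?andbF // andbT.
  case: (boolP (x \in H j)) => //= xj; rewrite ?andbF // andbT.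
  by apply: contra xj => /subsetP; exact.
(* Double counting of pairs [(x, j)] with [x] in [W] and in [H j], weighted by [u j]: each light [x]
   keeps weight at least [sg - a], and each [j] meets at most [g'] elements by induction. *)
have main : #|W|%:R * (sg - a%:R) <= sg * g'%:R.
  apply: (@le_trans _ _ (\sum_(x in W) \sum_(j in E :\: B' | x \in H j) u j)).
    rewrite mulr_natl -sumr_const; apply: ler_sum => x xW.
    rewrite (split_sg x xW); move: xW; rewrite inE => /andP[_]; lra.
  rewrite (exchange_big_dep (fun j => j \in E :\: B')) /=; last by move=> x j _ /andP[].
  rewrite mulr_suml; apply: ler_sum => j jE.
  rewrite jE /= sumr_const -[leLHS]mulr_natr ler_wpM2l // ler_nat.
  apply: leq_trans (cnt j jE); apply/subset_leq_card/subsetP => x.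
  by rewrite in_setI.
have sgE : g%:R * (s.+1%:R - a%:R) = s.+1%:R * g'%:R :> K.
  rewrite -natrB ?(ltnW sa) // -!natrM; congr (_%:R).
  transitivity (#|common H E| * p ^ a * ((s.+1 - a) * 'C(maxn s.+1 a, a)))%N.
    by rewrite /g; ring.
  by rewrite -bin_maxn_step // /g'; ring.
have {sa} sa : a%:R < s.+1%:R :> K by rewrite ltr_nat.
rewrite -(ler_nat K).
have a0 : 0 <= a%:R :> K by [].
have g0 : 0 <= g'%:R :> K by [].
(* In [main], [sg] may be lowered to [s.+1] only when [W] has at least [g'] elements; otherwise
   [g' <= g] is enough. *)
have [Ng|/ltW gN] := lerP #|W|%:R (g'%:R : K).
  rewrite -(ler_pM2r (x := s.+1%:R - a%:R)) ?subr_gt0 // sgE mulrC.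
  rewrite ler_pM //; first by rewrite subr_ge0 ltW.
  by rewrite gerBl.
rewrite -(ler_pM2r (x := s.+1%:R - a%:R)) ?subr_gt0 // sgE.
have : s.+1%:R * (#|W|%:R - g'%:R) <= sg * (#|W|%:R - g'%:R) by rewrite ler_wpM2r // subr_ge0.
lra.
Qed.

(** * Independent sampling *)

Lemma exp_add (x y : R) : exp (x + y) = exp x * exp y.
Proof. exact: exp_plus. Qed.

Lemma exp_gt0 (x : R) : 0 < exp x.
Proof. apply/RltP; exact: exp_pos. Qed.

Lemma exp_ge1Dx (x : R) : 1 + x <= exp x.
Proof. apply/RleP; exact: exp_ineq1_le. Qed.

Lemma exp0 : exp 0 = 1 :> R.
Proof. exact: exp_0. Qed.

Lemma exp_le (x y : R) : x <= y -> exp x <= exp y.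
Proof.
move=> xy; have -> : y = x + (y - x) by ring.
rewrite exp_add ler_peMr ?(ltW (exp_gt0 x)) //.
by apply: le_trans (exp_ge1Dx _); lra.
Qed.

Lemma exp_sum (I : finType) (A : {set I}) (f : I -> R) :
  exp (\sum_(j in A) f j) = \prod_(j in A) exp (f j).
Proof. by apply: (big_morph exp exp_add); exact: exp0. Qed.

(** From [1 - t <= exp (- t)] follows [exp t <= 1 / (1 - t)], and the quadratic times [1 - t] is
    [1 + t ^+ 2 * (1 - 2 * t)]. *)
Lemma exp_quadratic (t : R) : t <= 1 / 2 -> exp t <= 1 + t + 2 * t ^+ 2.
Proof.
move=> t2; have h := exp_ge1Dx (- t); have := exp_add t (- t).
rewrite subrr exp0 => e1; have := exp_gt0 t; move: h e1.
set e := exp t; set e' := exp (- t) => h e1 e0.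
have h1 : e * (1 - t) <= 1 by rewrite [leRHS]e1 ler_pM2l.
have h2 : 1 <= (1 + t + 2 * t ^+ 2) * (1 - t).
  have -> : (1 + t + 2 * t ^+ 2) * (1 - t) = 1 + t ^+ 2 * (1 - 2 * t) by ring.
  by rewrite lerDl mulr_ge0 ?sqr_ge0 //; lra.
rewrite -(ler_pM2r (x := 1 - t)); last lra.
exact: le_trans h1 h2.
Qed.

(** For [1 <= a] the element is always kept and deviates by 0. For [a < 1] the deviation is [1 - a]
    or [- a]; factoring out [exp (- (t * a))] leaves [1 + a * (exp t - 1)], to which the quadratic
    bound applies. *)
Lemma sample_mgf (a t : R) : 0 <= a -> t <= 1 / 2 ->
  Num.min 1 a * exp (t * (a * ((Num.min 1 a)^-1 - 1))) + (1 - Num.min 1 a) * exp (t * (a * (0 - 1)))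
    <= exp (2 * t ^+ 2 * a).
Proof.
move=> a0 t2; case: (leP 1 a) => [a1|a1].
  rewrite subrr mul0r addr0 mul1r invr1 subrr !mulr0 exp0.
  by apply: le_trans (exp_ge1Dx _); have := mulr_ge0 (sqr_ge0 t) a0; lra.
(* Here [0^-1 = 0], so the cancellation [a * a^-1 = 1] used below would fail. *)
have [->|an0] := eqVneq a 0.
  by rewrite mul0r add0r !(mulr0, mul0r) exp0 subr0 mulr1.
have -> : a * (a^-1 - 1) = 1 - a by rewrite mulrBr mulfV // mulr1.
have -> : t * (1 - a) = t + - (t * a) by ring.
have -> : t * (a * (0 - 1)) = - (t * a) by ring.
have -> : 2 * t ^+ 2 * a = - (t * a) + (t * a + 2 * t ^+ 2 * a) by ring.
rewrite [exp (t + _)]exp_add [exp (- _ + (_ + _))]exp_add.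
apply: (@le_trans _ _ (exp (- (t * a)) * (1 + (t * a + 2 * t ^+ 2 * a)))).
  have := exp_quadratic t2; have := exp_gt0 (- (t * a)).
  set e := exp t; set e' := exp (- _) => e'0 h.
  have -> : a * (e * e') + (1 - a) * e' = e' * (1 + a * (e - 1)) by ring.
  rewrite ler_pM2l // lerD2l.
  have : a * (e - 1) <= a * (t + 2 * t ^+ 2) by rewrite ler_wpM2l //; lra.
  lra.
by rewrite ler_pM2l ?exp_gt0 // exp_ge1Dx.
Qed.

Definition bernoulli_mean (I : finType) (p : I -> R) (F : {ffun I -> bool} -> R) : R :=
  \sum_(f : {ffun I -> bool}) (\prod_j (if f j then p j else 1 - p j)) * F f.

Lemma bernoulli_mean_prod (I : finType) (p : I -> R) (h : I -> bool -> R) :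
  bernoulli_mean p (fun f => \prod_j h j (f j))
    = \prod_j (p j * h j true + (1 - p j) * h j false).
Proof.
transitivity (\prod_j \sum_(b : bool) (if b then p j else 1 - p j) * h j b).
  rewrite bigA_distr_bigA; apply: eq_bigr => f _; by rewrite big_split.
by apply: eq_bigr => j _; rewrite big_bool.
Qed.

Lemma bernoulli_mean1 (I : finType) (p : I -> R) : bernoulli_mean p (fun=> 1) = 1.
Proof.
have := bernoulli_mean_prod p (fun _ _ => 1).
under [RHS]eq_bigr do rewrite !mulr1 addrC subrK.
by rewrite !big1_eq.
Qed.

Lemma bernoulli_meanD (I : finType) (p : I -> R) (F G : {ffun I -> bool} -> R) :
  bernoulli_mean p (fun f => F f + G f) = bernoulli_mean p F + bernoulli_mean p G.
Proof. by rewrite -big_split; apply: eq_bigr => f _; rewrite mulrDr. Qed.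

Lemma bernoulli_meanZ (I : finType) (p : I -> R) (c : R) (F : {ffun I -> bool} -> R) :
  bernoulli_mean p (fun f => c * F f) = c * bernoulli_mean p F.
Proof. by rewrite mulr_sumr; apply: eq_bigr => f _; rewrite mulrCA. Qed.

Lemma bernoulli_mean_sum (I : finType) (p : I -> R) (J : Type) (s : seq J) (Q : pred J)
    (F : J -> {ffun I -> bool} -> R) :
  bernoulli_mean p (fun f => \sum_(i <- s | Q i) F i f)
    = \sum_(i <- s | Q i) bernoulli_mean p (F i).
Proof.
by rewrite [RHS]exchange_big; apply: eq_bigr => f _; rewrite mulr_sumr.
Qed.

Lemma bernoulli_mean_coord (I : finType) (p : I -> R) (j : I) :
  bernoulli_mean p (fun f => (f j : nat)%:R) = p j.
Proof.
have := bernoulli_mean_prod p (fun i b => if i == j then (b : nat)%:R else 1).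
rewrite [RHS](bigD1 j) //= eqxx mulr1 mulr0 addr0 [X in _ * X]big1 ?mulr1.
  move=> <-; apply: eq_bigr => f _; congr (_ * _).
  rewrite (bigD1 j) //= eqxx big1 ?mulr1 // => i /negbTE -> //.
by move=> i /negbTE ->; rewrite !mulr1 addrC subrK.
Qed.

Lemma bernoulli_mean_witness (I : finType) (p : I -> R) (F : {ffun I -> bool} -> R) (c : R) :
    (forall j, 0 <= p j <= 1) -> bernoulli_mean p F < c ->
  exists f, F f < c.
Proof.
move=> p01 Fc; apply/existsP; apply: contraLR Fc => /existsPn h.
rewrite -leNgt -[c]mulr1 -(bernoulli_mean1 p) -bernoulli_meanZ.
apply: ler_sum => f _; rewrite mulr1; apply: ler_wpM2l; last by rewrite leNgt h.
by apply: prodr_ge0 => j _; have := p01 j; case: (f j); lra.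
Qed.

Lemma sample_sum_mgf (I : finType) (a : I -> R) (A : {set I}) (t : R) :
    (forall j, 0 <= a j) -> t <= 1 / 2 ->
  bernoulli_mean (fun j => Num.min 1 (a j)) (fun f =>
      exp (t * \sum_(j in A) a j * ((f j : nat)%:R / Num.min 1 (a j) - 1)))
    <= exp (2 * t ^+ 2 * \sum_(j in A) a j).
Proof.
move=> a0 t2.
pose h j (b : bool) := if j \in A then
  exp (t * (a j * ((b : nat)%:R / Num.min 1 (a j) - 1))) else 1.
have -> : bernoulli_mean (fun j => Num.min 1 (a j)) (fun f =>
    exp (t * \sum_(j in A) a j * ((f j : nat)%:R / Num.min 1 (a j) - 1))) =
    bernoulli_mean (fun j => Num.min 1 (a j)) (fun f => \prod_j h j (f j)).
  apply: eq_bigr => f _; congr (_ * _).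
  by rewrite mulr_sumr exp_sum big_mkcond.
rewrite bernoulli_mean_prod mulr_sumr exp_sum [leRHS]big_mkcond /=.
have p01 j : 0 <= Num.min 1 (a j) <= 1 by rewrite le_min ler01 a0 ge_min lexx.
apply: ler_prod => j _; rewrite /h.
case: ifP => _; last by rewrite !mulr1 addrC subrK ler01 lexx.
rewrite mul1r mul0r sample_mgf // andbT.
by have := p01 j => /andP[? ?]; rewrite addr_ge0 // mulr_ge0 ?subr_ge0 // ltW ?exp_gt0.
Qed.

(** * Union bound over the traces of one layer *)

Lemma exp_natmul (x : R) (k : nat) : exp (x * k%:R) = exp x ^+ k.
Proof.
elim: k => [|k IHk]; first by rewrite mulr0 exp0.
by rewrite exprS -IHk -exp_add; congr exp; rewrite mulrS; ring.
Qed.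

Lemma bin_leq_expn n m : ('C(n, m) <= n ^ m)%N.
Proof.
apply: (@leq_trans (n ^_ m)).
  by rewrite -bin_ffact leq_pmulr ?fact_gt0.
elim: m => [|m IHm]; first by rewrite ffactn0.
by rewrite ffactnSr expnSr leq_mul // leq_subr.
Qed.

Lemma unit_interval_cover (n : nat) (s : R) : (0 < n)%N -> 1 <= s -> s <= n.+1%:R ->
  exists i : 'I_n, i.+1%:R <= s <= i.+2%:R.
Proof.
case: n => // n _ s1; elim: n => [|n IHn] sn; first by exists ord0; rewrite s1 sn.
have [h|h] := lerP s n.+2%:R; last by exists ord_max; rewrite (ltW h) sn.
by have [i hi] := IHn h; exists (widen_ord (leqnSn _) i).
Qed.

(** The trace of [x] on [E]; in the graph analogy, the edges of a cut. *)
Definition moved (gT : finGroupType) (I : finType) (H : I -> {group gT}) (E : {set I})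
  (x : gT) : {set I} := [set j in E | x \notin H j].

Lemma moved_common (gT : finGroupType) (I : finType) (H : I -> {group gT}) (E : {set I}) x :
  x \in common H E -> moved H E x = set0.
Proof.
move=> /commonP h; apply/setP => j; rewrite !inE.
by case: (boolP (j \in E)) => // /h ->.
Qed.

Lemma moved_coset (gT : finGroupType) (I : finType) (H : I -> {group gT}) (E : {set I}) x y :
  y \in common H E :* x -> moved H E y = moved H E x.
Proof.
move=> /rcosetP[z /commonP zE ->]; apply/setP => j; rewrite !inE.
by case: (boolP (j \in E)) => // /zE zj; rewrite groupMl.
Qed.

(** Density is applied to the complement of the trace in [E]: [x] lies in its common subgroup but
    not in that of [E], so the rank gap is at least 1. *)
Lemma moved_ge1 (gT : finGroupType) (p : nat) (I : finType) (H : I -> {group gT})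
    (u : I -> R) (E : {set I}) (x : gT) :
    prime p -> p.-group [set: gT] -> rank_dense (corank p H) u E ->
  x \notin common H E -> 1 <= \sum_(j in moved H E x) u j.
Proof.
move=> p_pr pG dE xE.
have BE : E :\: moved H E x \subset E by apply: subsetDl.
have := dE _ BE.
have -> : E :\: (E :\: moved H E x) = moved H E x.
  by apply/setP => j; rewrite !inE; case: (j \in E); case: (x \in H j).
apply: le_trans.
have : (corank p H (E :\: moved H E x) < corank p H E)%N.
  apply: corank_lt => //; rewrite properE common_anti //=.
  apply: contra xE => /subsetP; apply; apply/commonP => j; rewrite !inE negb_and negbK.
  by case/andP => /orP[/negbTE ->|].
by rewrite -(ler_nat R) -natr1; lra.
Qed.

(** The elements are sorted into bands of weight between [i.+1] and [i.+2]. [card_light] bounds the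
    size of each band, and the choice of [lam] makes the exponential outweigh it. *)
Lemma sum_exp_moved (gT : finGroupType) (p n : nat) (I : finType) (H : I -> {group gT})
    (u : I -> R) (E : {set I}) (lam : R) :
    prime p -> p.-group [set: gT] -> (0 < n)%N -> (logn p #|gT| <= n)%N ->
    (forall j, 0 <= u j) -> rank_dense (corank p H) u E ->
    \sum_(j in E) u j <= n%:R -> exp lam = 8 * (p * n.+1)%:R ^+ 4 ->
  \sum_(x | x \notin common H E) exp (- lam * \sum_(j in moved H E x) u j)
    <= #|common H E|%:R / (8 * n%:R).
Proof.
move=> p_pr pG n0 hn u0 dE su elam.
set Q := (p * n.+1)%N; pose s x := \sum_(j in moved H E x) u j.
have p0 := prime_gt0 p_pr.
have Q0 : (0 < Q)%N by rewrite muln_gt0 p0.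
have QR0 : 0 < Q%:R :> R by rewrite ltr0n.
have lam0 : 0 <= lam.
  rewrite leNgt; apply/negP => /ltW /exp_le; rewrite exp0 elam leNgt => /negP; apply.
  have : 1 <= Q%:R ^+ 4 :> R by rewrite exprn_ege1 // ler1n.
  rewrite -/Q; lra.
have sn x : s x <= n%:R.
  apply: le_trans su; rewrite [leRHS](bigID (fun j => x \in H j)) /=.
  apply: (@le_trans _ _ (\sum_(j in E | x \notin H j) u j)).
    rewrite le_eqVlt; apply/orP; left; apply/eqP.
    by apply: eq_bigl => j; rewrite inE.
  by rewrite lerDr sumr_ge0.
pose N i := #|[set x | s x <= i.+2%:R]|.
have step1 : \sum_(x | x \notin common H E) exp (- lam * s x)
    <= \sum_(i < n) (N i)%:R * exp (- lam * i.+1%:R).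
  apply: (@le_trans _ _ (\sum_(x : gT)
     \sum_(i < n | s x <= i.+2%:R) exp (- lam * i.+1%:R))).
    rewrite big_mkcond /=; apply: ler_sum => x _.
    have pos (i : 'I_n) : s x <= i.+2%:R -> 0 <= exp (- lam * i.+1%:R).
      by move=> _; apply/ltW/exp_gt0.
    case: ifP => xE; last exact: sumr_ge0.
    have s1 : 1 <= s x by apply: (moved_ge1 p_pr pG).
    have [|i /andP[i1 i2]] := unit_interval_cover n0 s1.
      by apply: le_trans (sn x) _; rewrite ler_nat.
    rewrite (bigD1 i) //=; apply: (@le_trans _ _ (exp (- lam * i.+1%:R))).
      by apply: exp_le; rewrite !mulNr lerN2 ler_wpM2l.
    by rewrite lerDl sumr_ge0 // => j /andP[/pos].
  rewrite (exchange_big_dep predT) //=; apply: ler_sum => i _.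
  by rewrite sumr_const -[leLHS]mulr_natl /N cardsE.
apply: le_trans step1 _.
(* The count grows as [Q ^ i.+2], and a further [Q ^ 2] is to be spared; the exponent 4 in [lam] is
   what covers both at [i = 0]. *)
have Nle (i : 'I_n) : (N i * (8 * Q ^ 2) <= #|common H E| * (8 * Q ^ 4) ^ i.+1)%N.
  have := card_light (E := E) i.+2 p_pr pG u0 dE (sub0set E) (leqnn _).
  have -> : [set x in common H set0 | (\sum_(j in E | x \notin H j) u j <= i.+2%:R)%R]
      = [set x | (s x <= i.+2%:R)%R].
    apply/setP => x; rewrite !inE /s.
    have -> : x \in common H set0 by apply/commonP => j; rewrite inE.
    by congr (_ <= _)%R; apply: eq_bigl => j; rewrite inE.
  rewrite -/(N i) corank0 subn0 => h.
  apply: (@leq_trans (#|common H E| * (Q ^ i.+2) * (8 * Q ^ 2))%N).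
    rewrite leq_mul2r; apply/orP; right; apply: leq_trans h _.
    rewrite leq_mul2l; apply/orP; right; rewrite /Q mulnC expnMn leq_mul2l.
    apply/orP; right; apply: leq_trans (bin_leq_expn _ _) _.
    rewrite leq_exp2r // geq_max; have := corankE p H E.
    by have := ltn_ord i; lia.
  rewrite -mulnA leq_mul2l; apply/orP; right.
  rewrite mulnCA -expnD expnMn leq_mul //.
    by rewrite expnS leq_pmulr // expn_gt0.
  by rewrite -expnM leq_pexp2l //; lia.
have term (i : 'I_n) : (N i)%:R * exp (- lam * i.+1%:R) <= #|common H E|%:R / (8 * Q%:R ^+ 2).
  have eE : exp (lam * i.+1%:R) = (8 * Q%:R ^+ 4) ^+ i.+1 by rewrite exp_natmul elam.
  have e1 : exp (- lam * i.+1%:R) * exp (lam * i.+1%:R) = 1.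
    by rewrite -exp_add mulNr addNr exp0.
  have e0 := exp_gt0 (lam * i.+1%:R).
  rewrite ler_pdivlMr; last by rewrite mulr_gt0 // exprn_gt0.
  rewrite -(ler_pM2r e0).
  have -> : (N i)%:R * exp (- lam * i.+1%:R) * (8 * Q%:R ^+ 2) * exp (lam * i.+1%:R)
     = (N i)%:R * (8 * Q%:R ^+ 2) * (exp (- lam * i.+1%:R) * exp (lam * i.+1%:R)) by ring.
  rewrite e1 mulr1 eE.
  by have := Nle i; rewrite -(ler_nat R) !(natrM, natrX).
(* There are [n] bands and [n <= Q], so the spared [Q ^ 2] leaves a factor [1 / n]. *)
apply: le_trans (ler_sum _ (fun i _ => term i)) _.
rewrite sumr_const card_ord -[leLHS]mulr_natr -mulrA ler_wpM2l //.
have nR : 0 < n%:R :> R by rewrite ltr0n.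
have nQ : n%:R <= Q%:R :> R by rewrite ler_nat /Q; nia.
rewrite mulrC ler_pdivrMr ?mulr_gt0 ?exprn_gt0 // [leRHS]mulrC.
by rewrite ler_pdivlMr ?mulr_gt0 // expr2; nra.
Qed.

(** * Sparsifying a family of subgroups *)

Lemma exp_lt1 (x : R) : exp x < 1 -> x < 0.
Proof. by have := exp_ge1Dx x; lra. Qed.

Lemma subgroup_sparsifier (gT : finGroupType) (p n : nat) (I : finType)
    (H : I -> {group gT}) (eps : R) :
    prime p -> p.-group [set: gT] -> (0 < n)%N -> (logn p #|gT| <= n)%N ->
    0 < eps < 1 ->
  exists (T : {set I}) (w : I -> R),
    [/\ forall j, 0 <= w j,
        #|T|%:R <= 16 * n%:R * ln (8 * (p * n.+1)%:R ^+ 4) / eps ^+ 2 &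
        forall x : gT,
          `|\sum_(j in T | x \notin H j) w j - \sum_(j | x \notin H j) 1|
            <= eps * \sum_(j | x \notin H j) 1].
Proof.
move=> p_pr pG n0 hn /andP[eps0 eps1].
(* With [d0 = 0] the strength hypothesis is trivial and the layers recover each constraint of
   positive rank with coefficient exactly 1. *)
have [|u [L [[u0 du] su sL hL cov]]] := @strength_layers R I (corank p H) (corank0 p H)
    (@corank_mono _ p _ H) (fun A B => corank_submod H A B p_pr pG) setT 0 (lexx 0).
  by move=> B _; rewrite mul0r.
have rn E : (corank p H E <= n)%N by have := corankE p H E; lia.
have suE (E : {set I}) : \sum_(j in E) u j <= n%:R.
  apply: (@le_trans _ _ (corank p H setT)%:R); last by rewrite ler_nat.
  apply: le_trans su; rewrite (bigID (fun j => j \in E) (fun j => j \in setT)) /=.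
  rewrite -[leLHS]addr0 lerD ?sumr_ge0 // le_eqVlt; apply/orP; left; apply/eqP.
  by apply: eq_bigl => j; rewrite inE.
set Q := (p * n.+1)%:R : R.
have Q1 : 1 <= Q by rewrite ler1n muln_gt0 prime_gt0.
have Q4 : 8 <= 8 * Q ^+ 4 by rewrite ler_peMr // exprn_ege1.
set lam := ln _.
have elam : exp lam = 8 * Q ^+ 4 by apply: exp_ln; apply/RltP; apply: lt_le_trans Q4.
have lam0 : 0 < lam.
  rewrite ltNge; apply/negP => /exp_le; rewrite exp0 elam; lra.
have nR : 0 < n%:R :> R by rewrite ltr0n.
have e20 : 0 < eps ^+ 2 by rewrite exprn_gt0.
(* The choice [t = eps / 4] minimizes [2 * t ^+ 2 - t * eps], with value [- eps ^+ 2 / 8]; the 8 in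
   [rho] turns the exponent into [- lam * s E x]. *)
have [rho rhoD] : exists rho, rho = 8 * lam / eps ^+ 2 by eexists.
have [t tD] : exists t, t = eps / 4 by eexists.
have rho0 : 0 < rho by rewrite rhoD divr_gt0 // mulr_gt0.
have rhoE : rho * eps ^+ 2 = 8 * lam by rewrite rhoD divfK // gt_eqF.
have rn0 : 0 < 2 * rho * n%:R by rewrite !mulr_gt0.
have rni0 : 0 <= (2 * rho * n%:R)^-1 by rewrite invr_ge0 ltW.
pose a j := rho * u j; pose P j := Num.min 1 (a j).
have a0 j : 0 <= a j by rewrite mulr_ge0 // ltW.
have P01 j : 0 <= P j <= 1 by rewrite /P le_min ler01 a0 ge_min lexx.
pose dev E x (f : {ffun I -> bool}) :=
  \sum_(j in moved H E x) a j * ((f j : nat)%:R / P j - 1).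
pose s E x := \sum_(j in moved H E x) u j.
(* Two-sided exponential penalty: it is at least 1 as soon as the deviation reaches
   [eps * rho * s E x] in absolute value. *)
pose phi E x f := exp (- (t * eps * rho * s E x)) * exp (t * dev E x f)
                + exp (- (t * eps * rho * s E x)) * exp (- t * dev E x f).
have phi0 E x f : 0 <= phi E x f by rewrite addr_ge0 // mulr_ge0 // ltW ?exp_gt0.
have sa E x : \sum_(j in moved H E x) a j = rho * s E x by rewrite mulr_sumr.
have Ephi E x : bernoulli_mean P (phi E x) <= 2 * exp (- lam * s E x).
  rewrite bernoulli_meanD !bernoulli_meanZ.
  have h1 : t <= 1 / 2 by rewrite tD; lra.
  have h2 : - t <= 1 / 2 by rewrite tD; lra.
  have := sample_sum_mgf (moved H E x) a0 h1; have := sample_sum_mgf (moved H E x) a0 h2.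
  rewrite sa sqrrN -/P -/(dev E x) => m2 m1.
  have -> : exp (- lam * s E x)
      = exp (- (t * eps * rho * s E x)) * exp (2 * t ^+ 2 * (rho * s E x)).
    rewrite -exp_add; congr exp.
    have -> : - lam = - (rho * eps ^+ 2) / 8 by rewrite rhoE; field.
    by rewrite tD; field.
  have := exp_gt0 (- (t * eps * rho * s E x)); set e := exp (- _) => e0.
  have := ler_pM2l e0; move=> /(_ _ _) M; rewrite mulrDl mul1r.
  by apply: lerD; rewrite M.
(* One potential for all requirements. Its mean is at most [1 / 4] from the at most [n] layers plus
   [1 / 2] from the sample size, so some [f] has [Phi f < 1]. *)
pose Phi f := \sum_(l <- L) #|common H l.2|%:R^-1 *
    (\sum_(x | x \notin common H l.2) phi l.2 x f)
  + (2 * rho * n%:R)^-1 * \sum_j (f j : nat)%:R.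
have EPhi : bernoulli_mean P Phi < 1.
  rewrite bernoulli_meanD bernoulli_meanZ !bernoulli_mean_sum.
  have b1 : (2 * rho * n%:R)^-1 * \sum_j bernoulli_mean P (fun f => (f j : nat)%:R)
      <= 1 / 2.
    have -> : 1 / 2 = (2 * rho * n%:R)^-1 * (rho * n%:R) :> R.
      by field; rewrite !gt_eqF.
    rewrite ler_wpM2l //.
    apply: (@le_trans _ _ (rho * \sum_(j in setT) u j)).
      rewrite mulr_sumr; apply: (@le_trans _ _ (\sum_j rho * u j)).
        by apply: ler_sum => j _; rewrite bernoulli_mean_coord /P ge_min lexx orbT.
      rewrite le_eqVlt; apply/orP; left; apply/eqP.
      by apply: eq_bigl => j; rewrite inE.
    by rewrite ler_pM2l.
  have b2 : \sum_(l <- L) bernoulli_mean P (fun f => #|common H l.2|%:R^-1 *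
      (\sum_(x | x \notin common H l.2) phi l.2 x f)) <= 1 / 4.
    apply: (@le_trans _ _ (\sum_(l <- L) (4 * n%:R)^-1)).
      rewrite big_seq [leRHS]big_seq; apply: ler_sum => l /hL[_ _ dl].
      rewrite bernoulli_meanZ bernoulli_mean_sum.
      have Kgt : 0 < #|common H l.2|%:R :> R by rewrite ltr0n cardG_gt0.
      rewrite mulrC ler_pdivrMr //.
      apply: (@le_trans _ _ (\sum_(x | x \notin common H l.2) 2 * exp (- lam * s l.2 x))).
        by apply: ler_sum => x _; apply: Ephi.
      have := sum_exp_moved p_pr pG n0 hn u0 dl (suE _) elam.
      rewrite -mulr_sumr -/(s l.2) => h.
      have -> : (4 * n%:R)^-1 * #|common H l.2|%:R = 2 * (#|common H l.2|%:R / (8 * n%:R)) :> R.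
        by field; rewrite gt_eqF.
      by rewrite ler_pM2l.
    rewrite big_const_seq count_predT iter_addr_0 -[leLHS]mulr_natr.
    have -> : 1 / 4 = (4 * n%:R)^-1 * n%:R :> R by field; rewrite gt_eqF.
    rewrite ler_wpM2l ?invr_ge0 ?mulr_ge0 // ler_nat.
    exact: leq_trans sL (rn _).
  lra.
have [f Phif] := bernoulli_mean_witness P01 EPhi.
have sum0 l : 0 <= #|common H l.2|%:R^-1 * (\sum_(x | x \notin common H l.2) phi l.2 x f).
  by rewrite mulr_ge0 ?invr_ge0 // sumr_ge0.
have cnt0 : 0 <= (2 * rho * n%:R)^-1 * \sum_j (f j : nat)%:R.
  by rewrite mulr_ge0 ?sumr_ge0.
have Pj0 j : 0 <= P j by have /andP[] := P01 j.
have devle l x : l \in L -> `|dev l.2 x f| <= eps * rho * s l.2 x.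
  move=> lL; case: (boolP (x \in common H l.2)) => [/moved_common xE|xE].
    by rewrite /dev /s xE !big_set0 normr0 mulr0.
  have phi1 : phi l.2 x f < 1.
    apply: le_lt_trans Phif; rewrite /Phi (big_rem l lL) /= -addrA.
    rewrite -[leLHS]addr0 lerD //; last first.
      by apply: addr_ge0 => //; apply: sumr_ge0 => i _; exact: sum0.
    have Kgt : 0 < #|common H l.2|%:R :> R by rewrite ltr0n cardG_gt0.
    (* The penalty is constant on the coset of [x], so dividing the sum by the order of the common
       subgroup still leaves at least one full [phi]. *)
    rewrite mulrC ler_pdivlMr // mulr_natr -(card_rcoset _ x) -sumr_const.
    rewrite [leRHS]big_mkcond [leLHS]big_mkcond /=; apply: ler_sum => y _.
    case: ifP => yx; last by case: ifP.
    have yE : y \notin common H l.2.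
      apply: contra xE => yE; case/rcosetP: yx => z zE yE'.
      by rewrite -(groupMl x zE) -yE'.
    by rewrite yE /phi /dev /s (moved_coset yx).
  have t0 : 0 < t by rewrite tD divr_gt0.
  move: phi1; rewrite /phi -!exp_add => phi1.
  have p1 : exp (- (t * eps * rho * s l.2 x) + t * dev l.2 x f) < 1.
    by apply: le_lt_trans phi1; rewrite lerDl ltW ?exp_gt0.
  have p2 : exp (- (t * eps * rho * s l.2 x) + - t * dev l.2 x f) < 1.
    by apply: le_lt_trans phi1; rewrite lerDr ltW ?exp_gt0.
  move/exp_lt1: p1; move/exp_lt1: p2 => p2 p1.
  by rewrite ler_norml; apply/andP; split; rewrite -(ler_pM2l t0); lra.
(* If [x] is outside [H j], then [H j] is proper and [[set j]] has positive rank, as [cov]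
   requires. *)
have layers (g : I -> R) x : \sum_(j | x \notin H j) g j
    = \sum_(l <- L) l.1 * \sum_(j in moved H l.2 x) u j * g j.
  transitivity (\sum_(j | x \notin H j) \sum_(l <- L) l.1 * (j \in l.2)%:R * u j * g j).
    apply: eq_bigr => j xj; rewrite -mulr_suml cov ?inE //.
      by rewrite mul0r subr0 mul1r.
    rewrite -{1}(corank0 p H); apply: corank_lt => //; rewrite properE common_anti ?sub0set //=.
    apply: contra xj => /subsetP /(_ x) h.
    have /commonP : x \in common H [set j].
      by apply: h; apply/commonP => i; rewrite inE.
    by apply; rewrite inE.
  rewrite exchange_big /=; apply: eq_bigr => l _.
  rewrite mulr_sumr big_mkcond [RHS]big_mkcond /=; apply: eq_bigr => j _.
  rewrite inE; case: (j \in l.2); case: (x \notin H j) => //=.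
    by rewrite mulr1 mulrA.
  by rewrite mulr0 !mul0r.
exists [set j | f j], (fun j => (P j)^-1); split.
- by move=> j; rewrite invr_ge0.
- have -> : 16 * n%:R * lam / eps ^+ 2 = 2 * rho * n%:R by rewrite rhoD; ring.
  rewrite -[leRHS]mulr1 -ler_pdivrMl //.
  have -> : #|[set j | f j]|%:R = \sum_j (f j : nat)%:R :> R.
    rewrite -sum1_card natr_sum big_mkcond; apply: eq_bigr => j _.
    by rewrite inE; case: (f j).
  by apply: le_trans (ltW Phif); rewrite lerDr sumr_ge0.
move=> x.
have -> : \sum_(j in [set j | f j] | x \notin H j) (P j)^-1
    = \sum_(j | x \notin H j) (f j : nat)%:R / P j.
  rewrite big_mkcond [RHS]big_mkcond; apply: eq_bigr => j _.
  by rewrite inE; case: (f j); case: (x \notin H j) => //=; rewrite ?mul1r ?mul0r.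
rewrite -sumrB !layers mulr_sumr.
apply: le_trans (ler_norm_sum _ _ _) _.
rewrite big_seq [leRHS]big_seq; apply: ler_sum => l lL.
have [l0 _ _] := hL l lL.
rewrite normrM (ger0_norm l0) mulrCA ler_wpM2l //.
have dv := devle l x lL.
have dE : dev l.2 x f = rho * \sum_(j in moved H l.2 x) u j * ((f j : nat)%:R / P j - 1).
  by rewrite mulr_sumr; apply: eq_bigr => j _; rewrite mulrA.
move: dv; rewrite dE normrM (gtr0_norm rho0) mulrAC mulrC ler_pM2r //.
move/le_trans; apply; rewrite le_eqVlt; apply/orP; left; apply/eqP; congr (_ * _).
by apply: eq_bigr => j _; rewrite mulr1.
Qed.

(** * Ternary predicates *)

Definition table_val (t : seq bool) (b0 b1 b2 : bool) : bool :=
  nth false t (4 * b0 + 2 * b1 + b2).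

Definition bools := [:: false; true].
Definition lits := [:: L0; L1; LX; LNX; LY; LNY].

Definition table_proj (t : seq bool) : bool :=
  has (fun l0 => has (fun l1 => has (fun l2 =>
    all (fun x => all (fun y =>
      table_val t (eval_lit l0 x y) (eval_lit l1 x y) (eval_lit l2 x y) == x && y)
    bools) bools) lits) lits) lits.

Definition table_affine (p : nat) (t : seq bool) : bool :=
  has (fun a => has (fun a0 => has (fun a1 => has (fun a2 =>
    all (fun b0 : bool => all (fun b1 : bool => all (fun b2 : bool =>
      table_val t b0 b1 b2 == ((a + (a0 * b0 + (a1 * b1 + a2 * b2))) %% p != 0)%N)
    bools) bools) bools) (iota 0 p)) (iota 0 p)) (iota 0 p)) (iota 0 p).

(* The forms mod 2 are needed for the parity predicates only. *)
Lemma table_classification (t0 t1 t2 t3 t4 t5 t6 t7 : bool) :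
  let t := [:: t0; t1; t2; t3; t4; t5; t6; t7] in
  [|| table_proj t, table_affine 2 t | table_affine 5 t].
Proof. by case: t0 t1 t2 t3 t4 t5 t6 t7 => [] [] [] [] [] [] [] []; vm_compute. Qed.

(** Transfers the check of the 256 truth tables to [P], which sees its argument only through three
    values. *)
Lemma ternary_classification (P : pred_r 3) : ~ affine_proj_AND P ->
  exists (p c : nat) (a : 'I_3 -> nat), [/\ prime p, (p <= 5)%N &
    forall x : {ffun 'I_3 -> bool}, P x = ~~ (p %| c + \sum_i a i * x i)%N].
Proof.
move=> nP.
pose tri (T : Type) (z0 z1 z2 : T) (i : 'I_3) := nth z0 [:: z0; z1; z2] i.
pose g b0 b1 b2 := P [ffun i => tri bool b0 b1 b2 i].
have Pg (x : {ffun 'I_3 -> bool}) : P x = g (x ord0) (x (lift ord0 ord0)) (x ord_max).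
  rewrite /g; congr P; apply/ffunP => i; rewrite ffunE.
  by case: i => [[|[|[|i]]] hi] //; rewrite /tri /=; congr (x _); apply: val_inj.
pose t := [:: g false false false; g false false true; g false true false;
  g false true true; g true false false; g true false true; g true true false;
  g true true true].
have tg b0 b1 b2 : table_val t b0 b1 b2 = g b0 b1 b2 by case: b0; case: b1; case: b2.
have inb (b : bool) : b \in bools by case: b.
have aff (p : nat) : prime p -> (p <= 5)%N -> table_affine p t ->
    exists (p c : nat) (a : 'I_3 -> nat), [/\ prime p, (p <= 5)%N &
      forall x : {ffun 'I_3 -> bool}, P x = ~~ (p %| c + \sum_i a i * x i)%N].
  move=> pp p5 /hasP[c _ /hasP[a0 _ /hasP[a1 _ /hasP[a2 _ h]]]].
  exists p, c, (tri nat a0 a1 a2); split=> // x.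
  move/allP: h => /(_ _ (inb (x ord0))) /allP /(_ _ (inb (x (lift ord0 ord0)))).
  move=> /allP /(_ _ (inb (x ord_max))) /eqP; rewrite tg -Pg => ->.
  rewrite !big_ord_recl big_ord0 addn0 /dvdn /tri /=.
  by congr (~~ ((_ + (_ + (_ + _ * nat_of_bool (x _)))) %% _ == _)%N); apply: val_inj.
have := table_classification (g false false false) (g false false true)
  (g false true false) (g false true true) (g true false false) (g true false true)
  (g true true false) (g true true true).
rewrite /= -/t => /or3P[|/aff|/aff]; [|exact|exact].
rewrite /table_proj.
have hasl (f : lit -> bool) : has f lits -> exists l, f l.
  by rewrite /= => /orP[?|/orP[?|/orP[?|/orP[?|/orP[?|/orP[?|//]]]]]]; eexists; eassumption.
move=> /hasl[l0 /hasl[l1 /hasl[l2 h]]]; case: nP.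
exists (tri lit l0 l1 l2) => x y.
move/allP: h => /(_ _ (inb x)) /allP /(_ _ (inb y)) /eqP; rewrite tg => <-.
rewrite /g; congr P; apply/ffunP => i; rewrite !ffunE.
by case: i => [[|[|[|i]]] hi].
Qed.

(** * Quadratic lower bound *)

(** Variables 0 and 1 stand for the constants; each later block of four holds [x_q], its negation,
    [y_q] and its negation. Constraints cannot negate a variable, so negations get variables of
    their own. *)
Definition gadget_var (l : lit) (a b : nat) : nat :=
  match l with
  | L0 => 0 | L1 => 1
  | LX => 2 + 4 * a | LNX => 3 + 4 * a | LY => 4 + 4 * b | LNY => 5 + 4 * b
  end.

(** The assignment making only [x_a] true among the [x_q] and only [y_b] among the [y_q], with
    consistent negations and constants. *)
Definition gadget_assign (a b v : nat) : bool :=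
  if (v < 2)%N then v == 1%N else
  let q := ((v - 2) %/ 4)%N in
  match ((v - 2) %% 4)%N with
  | 0 => q == a | 1 => q != a | 2 => q == b | _ => q != b
  end.

Lemma gadget_assignE l a b a' b' :
  gadget_assign a b (gadget_var l a' b') = eval_lit l (a' == a) (b' == b).
Proof.
rewrite /gadget_assign; case: l => //=.
- have -> : ((2 + 4 * a' - 2) %/ 4)%N = a' by lia.
  by have -> : ((2 + 4 * a' - 2) %% 4)%N = 0%N by lia.
- have -> : ((3 + 4 * a' - 2) %/ 4)%N = a' by lia.
  by have -> : ((3 + 4 * a' - 2) %% 4)%N = 1%N by lia.
- have -> : ((4 + 4 * b' - 2) %/ 4)%N = b' by lia.
  by have -> : ((4 + 4 * b' - 2) %% 4)%N = 2%N by lia.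
- have -> : ((5 + 4 * b' - 2) %/ 4)%N = b' by lia.
  by have -> : ((5 + 4 * b' - 2) %% 4)%N = 3%N by lia.
Qed.

Lemma gadget_var_lt l a b n k : (a < n)%N -> (b < n)%N -> (4 * n + 2 <= k)%N ->
  (gadget_var l a b < k)%N.
Proof. by case: l => /=; lia. Qed.

Lemma dense_instance (P : pred_r 3) (n k : nat) : affine_proj_AND P ->
    (4 * n + 2 <= k)%N ->
  exists (m : nat) (cs : 'I_m -> 'I_3 -> 'I_k), m = (n * n)%N /\
    forall (eps : R) (T : {set 'I_m}) (w : 'I_m -> R), eps < 1 ->
      is_sparsifier P cs eps T w -> T = setT.
Proof.
case: k => [|k] [pi piP] hk; first by lia.
pose m := #|{: 'I_n * 'I_n}|; pose ab (j : 'I_m) : 'I_n * 'I_n := enum_val j.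
exists m, (fun j i => inord (gadget_var (pi i) (ab j).1 (ab j).2)); split.
  by rewrite /m card_prod card_ord.
set cs := (fun _ _ => _) => eps T w eps1 [_ hx].
apply/setP => j0; rewrite inE; apply: contraTT eps1 => j0T; rewrite -leNgt.
pose x : {ffun 'I_k.+1 -> bool} := [ffun v => gadget_assign (ab j0).1 (ab j0).2 (nat_of_ord v)].
have cv j : constr_val P cs j x = (j == j0)%:R.
  rewrite /constr_val; congr (_%:R); congr nat_of_bool.
  transitivity (P [ffun i => eval_lit (pi i) ((ab j).1 == (ab j0).1) ((ab j).2 == (ab j0).2)]).
    congr P; apply/ffunP => i; rewrite !ffunE /cs inordK ?gadget_assignE //.
    exact: gadget_var_lt (ltn_ord _) (ltn_ord _) hk.
  by rewrite piP -xpair_eqE -!surjective_pairing (inj_eq enum_val_inj).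
(* Without [j0] the weighted sum at [x] is 0, yet it must be at least [1 - eps]. *)
have [+ _] := hx x.
have -> : csp_value P cs x = 1.
  rewrite /csp_value (bigD1 j0) //= big1 => [|j /negbTE jj]; rewrite cv ?jj //.
  by rewrite eqxx addr0.
rewrite big1 => [|j jT]; first by rewrite mulr1 subr_le0.
by rewrite cv (negbTE (memPn j0T _ jT)) mulr0.
Qed.

(** * From hyperplanes over a prime field to the sparsifier *)

Lemma hyperplane_group_set (p n : nat) (v : 'cV['F_p]_n) :
  group_set [set y : 'rV['F_p]_n | y *m v == 0].
Proof.
apply/group_setP; split=> [|y z]; rewrite !inE; first by rewrite mul0mx.
by move=> /eqP y0 /eqP z0; rewrite mulmxDl y0 z0 addr0.
Qed.

Definition hyperplane (p n : nat) (v : 'cV['F_p]_n) : {group 'rV['F_p]_n} :=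
  Group (hyperplane_group_set v).

Lemma ln_le_natmul (x y : R) (k : nat) : 0 < x -> 0 < y -> x <= y ^+ k -> ln x <= k%:R * ln y.
Proof.
move=> x0 y0 xy; rewrite leNgt; apply/negP => h.
have ex : exp (ln x) = x by apply: exp_ln; apply/RltP.
have ey : exp (ln y) = y by apply: exp_ln; apply/RltP.
have : exp (ln y * k%:R) < exp (ln x).
  by rewrite mulrC; apply/RltP; apply: exp_increasing; apply/RltP.
by rewrite exp_natmul ex ey ltNge xy.
Qed.

Lemma ln_ge0 (x : R) : 1 <= x -> 0 <= ln x.
Proof.
move=> x1; have x0 : 0 < x by apply: lt_le_trans x1.
rewrite leNgt; apply/negP => h.
have : exp (ln x) < exp 0 by apply/RltP; apply: exp_increasing; apply/RltP.
by rewrite exp0 exp_ln ?ltNge ?x1 //; apply/RltP.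
Qed.

(** Dividing by [ln 2] cannot decrease a nonnegative number, because
    [1 + ln 2 <= exp (ln 2) = 2]. *)
Lemma ln_le_log2 (x : R) : 1 <= x -> ln x <= log2 x.
Proof.
move=> x1; have x0 : 0 < x by apply: lt_le_trans x1.
have e2 : exp (ln 2) = 2 by apply: exp_ln; apply/RltP; rewrite ltr0n.
have lx := ln_ge0 x1.
have l20 : 0 < ln 2.
  rewrite ltNge; apply/negP => /exp_le; rewrite exp0 e2; lra.
have l21 : ln 2 <= 1 by have := exp_ge1Dx (ln 2); rewrite e2; lra.
by rewrite /log2 RdivE ler_pdivlMr // ler_piMr.
Qed.

Lemma csp_sparsifier (P : pred_r 3) (p c : nat) (a : 'I_3 -> nat) :
    prime p -> (p <= 5)%N ->
    (forall x : {ffun 'I_3 -> bool}, P x = ~~ (p %| c + \sum_i a i * x i)%N) ->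
  forall eps : R, 0 < eps < 1 ->
  forall (k m : nat) (cs : 'I_m -> 'I_3 -> 'I_k.+1),
  exists (T : {set 'I_m}) (w : 'I_m -> R),
    is_sparsifier P cs eps T w /\
    #|T|%:R <= 320 * (k.+1%:R / eps ^+ 2) * log2 (4 * k.+1%:R / eps)%R.
Proof.
move=> p_pr p5 PE eps eps01 k m cs; have /andP[eps0 eps1] := eps01.
(* Coordinate 0 carries the constant term, matched by the entry 1 of [row]; being a sum, the vector
   stays correct when a constraint repeats a variable. *)
pose coef j : 'cV['F_p]_k.+2 := c%:R *: delta_mx ord0 ord0
  + \sum_i (a i)%:R *: delta_mx (lift ord0 (cs j i)) ord0.
have cardV : #|{: 'rV['F_p]_k.+2}| = (p ^ k.+2)%N.
  by rewrite card_mx mul1n card_Fp.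
have pG : p.-group [set: 'rV['F_p]_k.+2].
  by rewrite /pgroup cardsT cardV pnatX pnat_id.
have lV : (logn p #|{: 'rV['F_p]_k.+2}| <= k.+2)%N by rewrite cardV pfactorK.
have [T [w [w0 Tn hw]]] :=
  subgroup_sparsifier (fun j => hyperplane (coef j)) p_pr pG (ltn0Sn k.+1) lV eps01.
pose row (x : {ffun 'I_k.+1 -> bool}) : 'rV['F_p]_k.+2 :=
  \row_i (if unlift ord0 i is Some v then (x v : nat)%:R else 1).
have rowE x j : (row x \in hyperplane (coef j)) = ~~ P [ffun i => x (cs j i)].
  rewrite inE PE negbK (dvdn_pcharf (pchar_Fp p_pr)).
  have -> : (row x *m coef j == 0) = ((row x *m coef j) 0 0 == 0).
    apply/eqP/eqP => [->|h]; first by rewrite mxE.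
    by apply/matrixP => i l; rewrite !ord1 h mxE.
  congr (_ == 0); rewrite mulmxDr mulmx_sumr mxE -scalemxAr -colE !mxE unlift_none mulr1.
  rewrite summxE natrD natr_sum; congr (_ + _); apply: eq_bigr => i _.
  by rewrite -scalemxAr -colE !mxE liftK natrM ffunE.
exists T, w; split; last first.
  apply: le_trans Tn _.
  (* The constant is [320 = 16 * 2 * 10]: the dimension [k.+2] is at most [2 * K], and
     [8 * Q ^+ 4 <= (4 * K) ^+ 10] bounds the logarithm by [10 * ln z]. *)
  set K := k.+1%:R : R; set Q := (p * k.+3)%:R : R; set z := 4 * K / eps.
  have K1 : 1 <= K by rewrite ler1n.
  have Q0 : 0 <= Q by [].
  have QK : Q <= 15 * K by rewrite /Q /K -natrM ler_nat; nia.
  have e20 : 0 < eps ^+ 2 by rewrite exprn_gt0.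
  have zK : 4 * K <= z by rewrite ler_pdivlMr // ler_piMr; lra.
  have Q40 : 0 < 8 * Q ^+ 4.
    by rewrite mulr_gt0 // exprn_gt0 // ltr0n muln_gt0 prime_gt0.
  have lamz : ln (8 * Q ^+ 4) <= 10%:R * ln z.
    apply: ln_le_natmul => //; first lra.
    apply: (@le_trans _ _ ((4 * K) ^+ 10)); last by rewrite lerXn2r ?nnegrE; lra.
    have Qy : Q <= (4 * K) ^+ 2 by rewrite expr2; nra.
    have -> : (4 * K) ^+ 10 = (4 * K) ^+ 2 * ((4 * K) ^+ 2) ^+ 4 by rewrite -exprM -exprD.
    apply: ler_pM => //; first by rewrite exprn_ge0.
      by rewrite expr2; nra.
    by rewrite lerXn2r ?nnegrE ?exprn_ge0 //; lra.
  have lz : ln z <= log2 z by apply: ln_le_log2; lra.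
  have n2 : k.+2%:R <= 2 * K by rewrite -natr1 -/K; lra.
  have lz0 : 0 <= log2 z.
    by apply: le_trans lz; apply: ln_ge0; lra.
  have -> : 320 * (K / eps ^+ 2) * log2 z = 320 * K * log2 z / eps ^+ 2 by ring.
  rewrite ler_pM2r ?invr_gt0 //.
  apply: (@le_trans _ _ (16 * k.+2%:R * (10%:R * log2 z))).
    rewrite ler_wpM2l ?mulr_ge0 //; lra.
  have := ler_wpM2r lz0 n2; lra.
split=> [j _|x]; first exact: w0.
have vE j : constr_val P cs j x = (row x \notin hyperplane (coef j))%:R.
  by rewrite rowE negbK.
have s1 : csp_value P cs x = \sum_(j | row x \notin hyperplane (coef j)) 1.
  rewrite [RHS]big_mkcond; apply: eq_bigr => j _; rewrite vE.
  by case: (_ \notin _).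
have s2 : \sum_(j in T) w j * constr_val P cs j x
    = \sum_(j in T | row x \notin hyperplane (coef j)) w j.
  rewrite [RHS]big_mkcondr; apply: eq_bigr => j _; rewrite vE.
  by case: (_ \notin _); rewrite ?mulr1 ?mulr0.
have := hw (row x); rewrite s1 s2 ler_norml => /andP[]; lra.
Qed.

Theorem theorem1p6 (P : pred_r 3) :
  (~ affine_proj_AND P ->
     exists C c : R,
       forall eps : R, 0 < eps < 1 ->
       forall (k m : nat) (cs : 'I_m -> 'I_3 -> 'I_k),
       exists (T : {set 'I_m}) (w : 'I_m -> R),
         is_sparsifier P cs eps T w /\
         (#|T|%:R <= C * (k%:R / eps ^+ 2) * Rpower (log2 (4 * k%:R / eps)) c))
  /\
  (affine_proj_AND P ->
     exists c0 : R, 0 < c0 /\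
       forall eps : R, 0 <= eps < 1 ->
       exists K : nat, forall k : nat, (K <= k)%N ->
       exists (m : nat) (cs : 'I_m -> 'I_3 -> 'I_k),
       forall (T : {set 'I_m}) (w : 'I_m -> R),
         is_sparsifier P cs eps T w -> c0 * k%:R ^+ 2 <= #|T|%:R).
Proof.
split=> [/ternary_classification[p [c [a [p_pr p5 PE]]]]|proj].
  exists 320, (IZR 1) => eps eps01 [|k] m cs.
    have no (j : 'I_m) : False by case: (cs j ord0).
    exists set0, (fun=> 0); split.
      split=> [j|x]; first by case: (no j).
      by rewrite /csp_value !big1 ?mulr0 // => j; case: (no j).
    by rewrite cards0 mul0r mulr0 mul0r.
  have [T [w [hT Tn]]] := csp_sparsifier p_pr p5 PE eps01 cs.
  have /andP[eps0 eps1] := eps01.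
  have k1 : 1 <= k.+1%:R :> R by rewrite ler1n.
  have z1 : 1 < (4 * k.+1%:R / eps)%R by rewrite ltr_pdivlMr //; lra.
  (* The left argument of [log2] is built from the operations of [Reals], the right one from ring
     operations. *)
  have zE : log2 (4 * k.+1%:R / eps) = log2 (4 * k.+1%:R / eps)%R.
    by rewrite RdivE RmultE -[IZR 4]/(IZR (Z.of_nat 4)) -INR_IZR_INZ INRE.
  exists T, w; split=> //; rewrite zE Rpower_1 //.
  apply/RltP; apply: lt_le_trans (ln_le_log2 (ltW z1)).
  by apply/RltP; rewrite -ln_1; apply: ln_increasing; [exact: Rlt_0_1|exact/RltP].
(* With [n = (k - 2) %/ 4] blocks, [k <= 8 * n] holds from [k = 10] on, hence
   [k ^ 2 <= 64 * n ^ 2]. *)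
exists (64%:R^-1); split; first by rewrite invr_gt0.
move=> eps /andP[_ eps1]; exists 10%N => k k10.
have hn : (4 * ((k - 2) %/ 4) + 2 <= k)%N by lia.
have [m [cs [mE full]]] := dense_instance proj hn.
exists m, cs => T w /(full eps T w eps1) ->.
rewrite cardsT card_ord mE mulrC ler_pdivrMr // -natrX -natrM ler_nat.
have : (k <= 8 * ((k - 2) %/ 4))%N by lia.
by move: (_ %/ _)%N => n; nia.
Qed.
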